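(* Let $n\ge 2$ be an integer, $u\in H^1(0,1)$ and $h\in L^2(0,1)$. Then $$\big(\mathrm{Id}_m^{-1}(u'')\,\big|\,h\big)_{H^{-1}(T)}=-\int_0^1u\,\overline h\,dx+u(1)\overline{\mu_0(h)}+\big(nu(0)-n(n-1)\mu_{n-2}(u)\big)\overline{\mu_1(h)}+\big((1-n)u(0)-u(1)+n(n-1)\mu_{n-2}(u)\big)\overline{\mu_n(h)}.$$
   Context: Functions are complex-valued. $H^1(T):=\{u\in H^1(0,1):u(0)=u(1)\}$, $H^{-1}(T)$ is its (anti)dual with $L^2(0,1)$ as pivot (so $L^2(0,1)\subset H^{-1}(T)$), and $\mathcal D(T)$ is the set of $C^\infty$ functions on $[0,1]$ all of whose derivatives coincide at $0$ and $1$. For $k\in\mathbb N_0$ and $f\in L^1(0,1)$, $\mu_k(f):=\int_0^1(1-x)^kf(x)\,dx$; for $f\in H^{-1}(T)$, $\mu_0(f):=\langle f,1\rangle$. $\mathrm{Id}_m^{-1}f$, for $f\in H^{-1}(0,1)$, denotes the unique $w\in H^{-1}(T)$ with $\mu_0(w)=0$ whose restriction to $H^1_0(0,1)\subset H^1(T)$ equals $f$. For $\varphi\in\mathcal D(T)$ let $J_n\varphi(x):=\int_x^1\varphi\,dy-\mu_0(\varphi)(1-x)^n$ and for $w\in H^{-1}(T)$ let $P_nw$ be the distribution $\varphi\mapsto\langle w,J_n\varphi\rangle$ (it lies in $L^2(0,1)$). The inner product on $H^{-1}(T)$ used here is $(w|v)_{H^{-1}(T)}:=\int_0^1P_nw\,\overline{P_nv}\,dx+\mu_0(w)\overline{\mu_0(v)}$.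 *)

(* Defs.v *)
(* MathComp-Analysis (Lebesgue integral, derivatives) over an
   abstract R : realType; complex numbers are R[i] from mathcomp-real-closed. *)
From HB Require Import structures.
From mathcomp Require Import all_boot all_order all_algebra.
From mathcomp Require Import all_classical all_reals all_analysis.
From mathcomp Require Import complex.

Set Implicit Arguments.
Unset Strict Implicit.
Unset Printing Implicit Defensive.

Import Order.TTheory GRing.Theory Num.Theory.
Import numFieldNormedType.Exports.
Local Open Scope classical_set_scope.
Local Open Scope ring_scope.
Local Open Scope complex_scope.

Section Defs.
Variable R : realType.
Local Notation C := R[i].
Local Notation mu := (@lebesgue_measure R).

Local Notation I01 := (`[0%R, 1%R]%classic : set R).

(* real and imaginary parts (record projections of complex) *)
Definition reC (z : C) : R := @complex.Re R z.
Definition imC (z : C) : R := @complex.Im R z.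

(* Integral over A of a complex-valued function: integral of real part plus
   'i times integral of imaginary part (Lebesgue measure on R). *)
Definition cint (A : set R) (f : R -> C) : C :=
  Complex (Rintegral mu A (fun x => reC (f x)))
          (Rintegral mu A (fun x => imC (f x))).

(* f ∈ L^2(0,1) *)
Definition L2 (f : R -> C) : Prop :=
  [/\ measurable_fun I01 (fun x => reC (f x)),
      measurable_fun I01 (fun x => imC (f x)) &
      (\int[mu]_(x in I01) ((reC (f x)) ^+ 2 + (imC (f x)) ^+ 2)%:E
        < +oo)%E].

(* g is the weak derivative of u on (0,1) and g ∈ L^2(0,1): u is then the
   (absolutely continuous representative of an) H^1(0,1) function with u' = g *)
Definition wderiv (u g : R -> C) : Prop :=
  L2 g /\ forall x : R, x \in I01 -> u x = u 0%R + cint `[0%R, x]%classic g.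

(* H^1(0,1) *)
Definition H1 (u : R -> C) : Prop := exists g, wderiv u g.
(* H^1(T) = {u ∈ H^1(0,1) : u(0) = u(1)} *)
Definition H1T (u : R -> C) : Prop := H1 u /\ u 0%R = u 1%R.
(* H^1_0(0,1) *)
Definition H10 (u : R -> C) : Prop := H1 u /\ u 0%R = 0 /\ u 1%R = 0.

(* Smooth (C^infty) real function on [0,1] whose derivatives of every order
   coincide at 0 and 1: F k is the k-th derivative. *)
Definition smoothT_real (f : R -> R) : Prop :=
  exists F : nat -> R -> R,
    (forall x : R, x \in I01 -> F 0%N x = f x) /\
    forall k : nat,
      [/\ {within I01, continuous (F k)},
          (forall x : R, x \in `]0%R, 1%R[%classic -> is_derive x 1%R (F k) (F k.+1 x)) &
          F k 0%R = F k 1%R].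

(* D(T) (complex-valued) *)
Definition DT (phi : R -> C) : Prop :=
  smoothT_real (fun x => reC (phi x)) /\ smoothT_real (fun x => imC (phi x)).

(* mu_k(f) for f ∈ L^1(0,1) *)
Definition mu_k (k : nat) (f : R -> C) : C :=
  cint I01 (fun x => ((1 - x) ^+ k)%:C * f x).

(* the constant function 1 *)
Definition one_fun : R -> C := fun _ => 1.

(* J_n phi (x) = \int_x^1 phi - mu_0(phi) (1-x)^n *)
Definition Jn (n : nat) (phi : R -> C) : R -> C :=
  fun x => cint `[x, 1%R]%classic phi - mu_k 0 phi * ((1 - x) ^+ n)%:C.

(* Elements of H^{-1}(T) are represented as functionals on test functions
   R -> C (only their values on H^1(T) matter); the duality bracket
   <w, phi> is  w phi,  antilinear in phi. *)
Definition antilinear_H1T (w : (R -> C) -> C) : Prop :=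
  (forall phi psi, H1T phi -> H1T psi -> w (phi \+ psi) = w phi + w psi) /\
  (forall (a : C) phi, H1T phi -> w (fun x => a * phi x) = a^* * w phi).

(* mu_0(w) = <w, 1> *)
Definition mu0 (w : (R -> C) -> C) : C := w one_fun.

(* Embedding L^2(0,1) ⊂ H^{-1}(T) (pivot L^2): <h, phi> = \int h conj(phi) *)
Definition embL2 (h : R -> C) : (R -> C) -> C :=
  fun phi => cint I01 (fun x => h x * (phi x)^*).

(* p ∈ L^2 is (a representative of) P_n w:  <w, J_n phi> = \int p conj(phi)
   for all phi ∈ D(T). *)
Definition is_Pn (n : nat) (w : (R -> C) -> C) (p : R -> C) : Prop :=
  L2 p /\ forall phi, DT phi ->
    w (Jn n phi) = cint I01 (fun x => p x * (phi x)^*).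

(* w = Id_m^{-1}(u'') for u ∈ H^1(0,1) with weak derivative u':
   w ∈ H^{-1}(T), mu_0(w) = 0 and for every phi ∈ H^1_0(0,1),
   <w, phi> = <u'', phi> = - \int u' conj(phi'). *)
Definition is_IdmInv_u2 (u' : R -> C) (w : (R -> C) -> C) : Prop :=
  [/\ antilinear_H1T w, mu0 w = 0 &
      forall phi phi', H10 phi -> wderiv phi phi' ->
        w phi = - cint I01 (fun x => u' x * (phi' x)^*)].

(* (w | v)_{H^{-1}(T)} given representatives p, q of P_n w, P_n v *)
Definition Hm1T_inner (w v : (R -> C) -> C) (p q : R -> C) : C :=
  cint I01 (fun x => p x * (q x)^*) + mu0 w * (mu0 v)^*.

End Defs.

(* Main.v *)
Require Import Defs.
From HB Require Import structures.
From mathcomp Require Import all_boot all_order all_algebra.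
From mathcomp Require Import all_classical all_reals all_analysis.
From mathcomp Require Import complex.
From mathcomp Require Import measurable_realfun.
From mathcomp Require Import ring lra.
Set Implicit Arguments.
Unset Strict Implicit.
Unset Printing Implicit Defensive.
Import Order.TTheory GRing.Theory Num.Theory.
Import numFieldNormedType.Exports.
Local Open Scope classical_set_scope.
Local Open Scope ring_scope.

(** On test functions, [J_n phi] lies in [H^1_0] with derivative
    [- phi + n mu_0(phi) (1-x)^(n-1)], hence [P_n w] and [P_n h] have the same pairings
    with D(T) as [u' - n mu_(n-1)(u')] and [H - mu_n(h)], where [H] is the primitive of [h]
    vanishing at 0.  Trigonometric polynomials suffice to identify the [L^2]
    representatives: for a trigonometric polynomial [s] with values in [0,1], the powers
    [(1 - s^m)^(2^m)] converge boundedly to the indicator of [s < 1/2] away from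
    [s = 1/2], so a function orthogonal to all of them has a vanishing primitive, and
    Lebesgue differentiation applies.  The inner product of the two explicit functions is
    computed with Fubini on the triangle [0 <= y <= x <= 1], which plays the role of
    integration by parts. *)

Section NegativeSobolevTorus.
Context {R : realType}.
Local Notation mu := (@lebesgue_measure R).
Local Notation I01 := (`[0%R, 1%R]%classic : set R).
Local Notation L1 f := (mu.-integrable I01 (EFin \o f)).
Implicit Types f g : R -> R.

(** * Fubini on the triangle *)

Lemma integrable_tensor f g : mu.-integrable setT (EFin \o f) ->
  mu.-integrable setT (EFin \o g) ->
  (mu \x mu)%E.-integrable setT (fun z : R * R => (f z.2 * g z.1)%:E).
Proof.
move=> fi gi.
have mf : measurable_fun setT f by move/measurable_int : fi => /measurable_EFinP.
have mg : measurable_fun setT g by move/measurable_int : gi => /measurable_EFinP.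
apply/integrable12ltyP => /=.
  apply/measurable_EFinP; apply: measurable_funM.
    exact: (measurableT_comp mf measurable_snd).
  exact: (measurableT_comp mg measurable_fst).
under eq_integral => x _.
  under eq_integral do rewrite normrM mulrC EFinM.
  rewrite ge0_integralZl//; last first.
    by apply/measurable_EFinP; exact: measurableT_comp.
  over.
have [_ fy] := integrableP _ _ _ fi; have [_ gy] := integrableP _ _ _ gi.
rewrite ge0_integralZr//; last 2 first.
- by apply/measurable_EFinP; exact: measurableT_comp.
- by apply: integral_ge0 => x _; rewrite lee_fin.
by apply: lte_mul_pinfty => //; [exact: integral_ge0|rewrite ge0_fin_numE//; exact: integral_ge0].
Qed.

(** The factor [(z.2 <= z.1)%R%:R] is the indicator of the triangle. It is measurable and at most 1,
    so the tensor product of the extensions by zero dominates. The first coordinate is the outer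
    point x and the second the inner point y. *)
Lemma integrable_triangle f g : L1 f -> L1 g ->
  (mu \x mu)%E.-integrable setT
    (fun z : R * R => ((f \_ I01) z.2 * (g \_ I01) z.1 * (z.2 <= z.1)%R%:R)%:E).
Proof.
move=> fi gi.
have fT : mu.-integrable setT (EFin \o (f \_ I01)).
  by rewrite -restrict_EFin; apply/(integrable_mkcond _ _).1.
have gT : mu.-integrable setT (EFin \o (g \_ I01)).
  by rewrite -restrict_EFin; apply/(integrable_mkcond _ _).1.
have tT := integrable_tensor fT gT.
apply: le_integrable tT => //.
- apply/measurable_EFinP; apply: measurable_funM.
    by have /measurable_int /measurable_EFinP := integrable_tensor fT gT.
  rewrite (_ : (fun _ => _) = \1_[set z : R * R | z.2 <= z.1]); last first.
    by apply/funext => z; rewrite indicE/= mem_setE.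
  apply: measurable_indic.
  rewrite -[X in measurable X]setTI.
  rewrite [X in _ `&` X](_ : _ = (fun z : R * R => z.2 <= z.1) @^-1` [set true]) //.
  have := measurable_fun_ler (@measurable_snd _ _ R R) (@measurable_fst _ _ R R).
  by move=> /(_ measurableT [set true]); apply.
- move=> z _ /=; rewrite lee_fin normrM ler_piMr// normr_nat.
  by case: (z.2 <= z.1)%R.
Qed.

Lemma triangle_sectionF f g : L1 f -> L1 g -> forall x,
  (\int[mu]_y ((f \_ I01) y * (g \_ I01) x * (y <= x)%R%:R)%:E)%E =
  (((fun x => (\int[mu]_(y in `[0, x]) f y) * g x) \_ I01) x)%:E.
Proof.
move=> fi gi x; rewrite [in RHS]patchE.
case: ifPn => [xI|xI]; last first.
  have gx : (g \_ I01) x = 0 by rewrite patchE (negPf xI).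
  by under eq_integral do rewrite gx mulr0 mul0r; rewrite integral0.
have [x0 x1] : 0 <= x /\ x <= 1 by move: xI; rewrite inE/= in_itv/= => /andP[].
have fx : mu.-integrable `[0, x] (EFin \o f).
  by apply: integrableS fi => //; apply: subset_itvl; rewrite bnd_simp.
have fxE : (\int[mu]_(y in `[0, x]) f y)%:E = (\int[mu]_(y in `[0%R, x]) (f y)%:E)%E.
  by rewrite fineK//; exact: integrable_fin_num.
rewrite EFinM fxE muleC [in RHS]integral_mkcond -integralZl//; last first.
  by apply/(integrable_mkcond _ _).1.
apply: eq_integral => y _; rewrite !patchE xI !mem_setE !in_itv/=.
have [yx|yx] := leP y x; rewrite ?andbT ?andbF ?mulr0 ?mule0//.
(* For y <= x <= 1 the upper bound of [I01] is automatic, so the triangle cuts out exactly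
   [0, x]. *)
rewrite (le_trans yx x1) andbT mulr1.
by case: ifP => _; rewrite ?mul0r ?mule0// mulrC EFinM.
Qed.

Lemma triangle_sectionG f g : L1 f -> L1 g -> forall y,
  (\int[mu]_x ((f \_ I01) y * (g \_ I01) x * (y <= x)%R%:R)%:E)%E =
  (((fun y => f y * \int[mu]_(x in `[y, 1]) g x) \_ I01) y)%:E.
Proof.
move=> fi gi y; rewrite [in RHS]patchE.
case: ifPn => [yI|yI]; last first.
  have fy : (f \_ I01) y = 0 by rewrite patchE (negPf yI).
  by under eq_integral do rewrite fy !mul0r; rewrite integral0.
have [y0 y1] : 0 <= y /\ y <= 1 by move: yI; rewrite inE/= in_itv/= => /andP[].
have gy : mu.-integrable `[y, 1] (EFin \o g).
  by apply: integrableS gi => //; apply: subset_itvr; rewrite bnd_simp.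
have gyE : (\int[mu]_(x in `[y, 1]) g x)%:E = (\int[mu]_(x in `[y, 1%R]) (g x)%:E)%E.
  by rewrite fineK//; exact: integrable_fin_num.
rewrite EFinM gyE [in RHS]integral_mkcond -integralZl//; last first.
  by apply/(integrable_mkcond _ _).1.
apply: eq_integral => x _; rewrite !patchE yI !mem_setE !in_itv/=.
have [yx|yx] := leP y x; rewrite ?andbT ?andbF ?mulr0 ?mule0//=.
rewrite (le_trans y0 yx) /= mulr1.
by case: ifP => _; rewrite ?mulr0 ?mule0// EFinM.
Qed.

(** The function is a marginal of the triangle integrand, hence integrable by Fubini. *)
Lemma integrable_primitiveM f g : L1 f -> L1 g ->
  L1 (fun x => (\int[mu]_(y in `[0, x]) f y) * g x).
Proof.
move=> fi gi; apply/(integrable_mkcond _ _).2 => //; rewrite restrict_EFin.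
have := integrable_fubini_F (integrable_triangle fi gi).
apply: eq_integrable => // x _; exact: triangle_sectionF.
Qed.

Lemma Rintegral_coprimitive g x : L1 g -> x \in I01 ->
  \int[mu]_(y in `[x, 1]) g y = \int[mu]_(y in I01) g y - \int[mu]_(y in `[0, x]) g y.
Proof.
move=> gi; rewrite mem_setE in_itv/= => /andP[x0 x1].
rewrite -Rintegral_itv_obnd_cbnd ?Rintegral_itvB ?bnd_simp//.
by apply: integrableS gi => //; apply: subset_itvr; rewrite bnd_simp.
Qed.

(** Splitting the integral over [y, 1] as the total integral minus the primitive reduces this to a
    multiple of f and [integrable_primitiveM]. *)
Lemma integrable_coprimitiveM f g : L1 f -> L1 g ->
  L1 (fun y => f y * \int[mu]_(x in `[y, 1]) g x).
Proof.
move=> fi gi.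
have := integrableB _ (integrableZl _ (\int[mu]_(y in I01) g y) fi)
  (integrable_primitiveM gi fi).
move=> /(_ (measurable_itv _) (measurable_itv _)).
apply: eq_integrable => // x xI /=.
rewrite (@Rintegral_coprimitive _ x)//.
rewrite mulrBr [f x * _]mulrC EFinB EFinM; congr (_ - _%:E)%E.
by rewrite mulrC.
Qed.

(** Both sides are iterated integrals of the same function on the triangle, taken in the two
    orders. *)
Lemma Rintegral_primitiveM f g : L1 f -> L1 g ->
  \int[mu]_(x in I01) ((\int[mu]_(y in `[0, x]) f y) * g x) =
  \int[mu]_(y in I01) (f y * \int[mu]_(x in `[y, 1]) g x).
Proof.
move=> fi gi; rewrite [LHS]Rintegral_mkcond [RHS]Rintegral_mkcond /Rintegral.
under eq_integral do rewrite -triangle_sectionF//.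
under [in RHS]eq_integral do rewrite -triangle_sectionG//.
by rewrite (Fubini (integrable_triangle fi gi)).
Qed.

(** * Totality of the trigonometric polynomials *)

(** The phase t brings in the sine, so that derivatives stay in the class; products bring in the
    higher frequencies. Being an algebra, the class contains the powers used for approximation. *)
Inductive trig_poly : (R -> R) -> Prop :=
| trig_cst c : trig_poly (fun=> c)
| trig_cos t : trig_poly (fun x => cos (2 * pi * x + t))
| trig_add f g : trig_poly f -> trig_poly g -> trig_poly (fun x => f x + g x)
| trig_mul f g : trig_poly f -> trig_poly g -> trig_poly (fun x => f x * g x).

Lemma trig_poly_exp f m : trig_poly f -> trig_poly (fun x => f x ^+ m).
Proof.
move=> tf; elim: m => [|m ihm].
  by under eq_fun do rewrite expr0; exact: trig_cst.
by under eq_fun do rewrite exprS; exact: trig_mul.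
Qed.

Lemma trig_poly_derivative f : trig_poly f ->
  exists2 g, trig_poly g & forall x : R, is_derive x 1 f (g x).
Proof.
elim=> [c|t|{}f1 f2 t1 [g1 tg1 d1] t2 [g2 tg2 d2]|{}f1 f2 t1 [g1 tg1 d1] t2 [g2 tg2 d2]].
- by exists (fun=> 0); [exact: trig_cst|move=> x; exact: is_derive_cst].
- exists (fun x => 2 * pi * cos (2 * pi * x + (t + pi / 2))).
    exact: trig_mul (trig_cst _) (trig_cos _).
  (* A shift of the phase by pi / 2 turns the cosine into minus the sine, which is its
     derivative. *)
  move=> x; rewrite addrA cosDpihalf [2 * pi * - _]mulrC.
  apply: (@is_derive1_comp _ cos (fun x => 2 * pi * x + t)).
  by apply: is_derive_eq; rewrite /GRing.scale/= ?(mulr1, mulr0, mul0r, addr0, add0r).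
- exists (fun x => g1 x + g2 x); first exact: trig_add.
  by move=> x; exact: is_deriveD.
- exists (fun x => f1 x * g2 x + f2 x * g1 x).
    by apply: trig_add; exact: trig_mul.
  by move=> x; exact: is_deriveM.
Qed.

Lemma trig_poly_derive1 f : trig_poly f -> trig_poly f^`()%classic.
Proof.
move=> /trig_poly_derivative[g tg dg]; suff -> : f^`()%classic = g by [].
by apply/funext => x; rewrite derive1E; have [_ ->] := dg x.
Qed.

Lemma trig_poly_continuous f : trig_poly f -> continuous f.
Proof.
move=> /trig_poly_derivative[g tg dg] x.
by apply: differentiable_continuous; apply/derivable1_diffP; have [] := dg x.
Qed.

Lemma trig_poly_periodic f : trig_poly f -> f 0 = f 1.
Proof.
elim=> // [t|? ? _ + _ +|? ? _ + _ +].
- by rewrite mulr0 mulr1 add0r addrC mulr_natl cosD2pi.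
- by move=> -> ->.
- by move=> -> ->.
Qed.

Lemma trig_poly_bounded f : trig_poly f -> exists M, forall x, `|f x| <= M.
Proof.
elim=> [c|t|f1 f2 _ [M1 b1] _ [M2 b2]|f1 f2 _ [M1 b1] _ [M2 b2]].
- by exists `|c|.
- by exists 1 => x; rewrite ler_norml cos_geN1 cos_le1.
- by exists (M1 + M2) => x; rewrite (le_trans (ler_normD _ _))// lerD.
- by exists (M1 * M2) => x; rewrite normrM ler_pM.
Qed.

(** Iterated derivatives are again trigonometric polynomials, hence continuous with equal values at
    0 and 1. *)
Lemma trig_poly_smoothT f : trig_poly f -> smoothT_real f.
Proof.
move=> tf; exists (fun k => f^`(k)%classic); split=> [//|k].
have tk : trig_poly f^`(k)%classic.
  by elim: k => // k ihk; rewrite derive1nS; exact: trig_poly_derive1.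
split; first exact/continuous_subspaceT/trig_poly_continuous.
- move=> x _; have [g _ dg] := trig_poly_derivative tk.
  by rewrite derive1nS derive1E; apply/derivableP; have [] := dg x.
- exact: trig_poly_periodic.
Qed.

(** * Powers converging to a step function *)

Lemma Bernoulli_ineq (a : R) N : a <= 1 -> 1 - N%:R * a <= (1 - a) ^+ N.
Proof.
move=> a1; elim: N => [|N ih]; first by rewrite mul0r subr0 expr0.
rewrite exprS; apply: le_trans (ler_wpM2l _ ih); last by rewrite subr_ge0.
rewrite -natr1; have : 0 <= N%:R * a ^+ 2 by rewrite mulr_ge0 ?sqr_ge0.
by rewrite expr2; lra.
Qed.

Lemma power_step_cvg1 (s : R) : 0 <= s < 2^-1 ->
  (1 - s ^+ m) ^+ (2 ^ m) @[m --> \oo] --> (1 : R).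
Proof.
move=> /andP[s0 s2].
have sm m : 0 <= s ^+ m <= 1 by rewrite exprn_ge0// exprn_ile1//; lra.
apply: (@squeeze_cvgr _ _ _ _ (fun m => 1 - (2 * s) ^+ m) (fun=> 1)).
- near=> m; apply/andP; split; last by rewrite exprn_ile1//; have := sm m; lra.
  (* Bernoulli with exponent 2^m bounds the power below by 1 - 2^m s^m = 1 - (2s)^m, where 2s <
     1. *)
  apply: le_trans (Bernoulli_ineq _ (andP (sm m)).2).
  by rewrite exprMn -natrX.
- rewrite -[X in _ --> X]subr0; apply: cvgB; first exact: cvg_cst.
  by apply: cvg_expr; rewrite ger0_norm; lra.
- exact: cvg_cst.
Unshelve. all: by end_near. Qed.

Lemma power_step_cvg0 (s : R) : 2^-1 < s <= 1 ->
  (1 - s ^+ m) ^+ (2 ^ m) @[m --> \oo] --> (0 : R).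
Proof.
move=> /andP[s2 s1].
have sm m : 0 <= s ^+ m <= 1 by rewrite exprn_ge0 ?exprn_ile1//; lra.
apply: (@squeeze_cvgr _ _ _ _ (fun=> 0) (fun m => (2 * s)^-1 ^+ m)).
- near=> m; apply/andP; split; first by rewrite exprn_ge0//; have := sm m; lra.
  have tsm : 0 < (2 * s) ^+ m by rewrite exprn_gt0//; lra.
  rewrite exprVn -[X in _ <= X]mulr1 ler_pdivlMl//.
  have [sm0 sm1] := andP (sm m); set a := s ^+ m.
  (* Bernoulli at -a gives this growth. Multiplying by (1 - a)^(2^m) leaves (1 - a^2)^(2^m) <= 1 on
     the right, so the power is at most (2s)^(-m), where 2s > 1. *)
  have : (2 * s) ^+ m <= (1 + a) ^+ (2 ^ m).
    have := @Bernoulli_ineq (- a) (2 ^ m); rewrite opprK mulrN opprK => /(_ _).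
    rewrite exprMn -natrX /a => h; apply: le_trans (h _); lra.
  move=> /(ler_wpM2r (_ : 0 <= (1 - a) ^+ (2 ^ m))) h.
  apply: le_trans (h _) _; first by rewrite exprn_ge0// subr_ge0.
  rewrite -exprMn exprn_ile1//; rewrite /a; nra.
- exact: cvg_cst.
- by apply: cvg_expr; rewrite ger0_norm ?invr_ge0 ?invf_lt1; lra.
Unshelve. all: by end_near. Qed.

(** * A trigonometric level function separating [0, b] from [b, 1] *)

Lemma cosB_cosD (a b : R) : cos (a - b) - cos (a + b) = 2 * (sin a * sin b).
Proof. by rewrite cosB cosD; ring. Qed.

(** The cosine vanishes against its value at x = 0 exactly at 0, b and 1 on [0, 1], for 0 < b < 1. A
    difference of cosines lies in [-2, 2], so division by 4 keeps the level in [0, 1]. *)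
Definition arc_level (b x : R) :=
  2^-1 - (cos (2 * pi * x - pi * b) - cos (pi * b)) / 4.

(** The cosine form shows the period and the range; this product form shows the sign of the
    deviation from 1/2, as both sines have known signs. *)
Lemma arc_levelE b x : arc_level b x = 2^-1 - sin (pi * x) * sin (pi * (b - x)) / 2.
Proof.
rewrite /arc_level; have -> : 2 * pi * x - pi * b = pi * x - pi * (b - x) by ring.
have -> : cos (pi * b) = cos (pi * x + pi * (b - x)) by congr cos; ring.
by rewrite cosB_cosD; field.
Qed.

Lemma arc_level_itv b x : 0 <= arc_level b x <= 1.
Proof.
rewrite /arc_level; set y := 2 * pi * x - _; set z := pi * b.
have := cos_geN1 y; have := cos_le1 y; have := cos_geN1 z; have := cos_le1 z.
by move=> *; lra.
Qed.

Lemma arc_level_lt b x : 0 < x < b -> b < 1 -> arc_level b x < 2^-1.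
Proof.
move=> /andP[x0 xb] b1; rewrite arc_levelE.
have sx : 0 < sin (pi * x).
  by rewrite sin_gt0_pi// mulr_gt0 ?pi_gt0//= gtr_pMr ?pi_gt0//; lra.
have sbx : 0 < sin (pi * (b - x)).
  by rewrite sin_gt0_pi// mulr_gt0 ?pi_gt0//= ?gtr_pMr ?pi_gt0//; lra.
by have := mulr_gt0 sx sbx; lra.
Qed.

Lemma arc_level_gt b x : b < x < 1 -> 0 < b -> 2^-1 < arc_level b x.
Proof.
move=> /andP[bx x1] b0; rewrite arc_levelE.
have sx : 0 < sin (pi * x).
  by rewrite sin_gt0_pi// mulr_gt0 ?pi_gt0//= ?gtr_pMr ?pi_gt0//; lra.
have sbx : 0 < sin (pi * (x - b)).
  by rewrite sin_gt0_pi// mulr_gt0 ?pi_gt0//= ?gtr_pMr ?pi_gt0//; lra.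
rewrite -(opprB x b) mulrN sinN mulrN.
by have := mulr_gt0 sx sbx; lra.
Qed.

Lemma trig_poly_arc_level b : trig_poly (arc_level b).
Proof.
rewrite (_ : arc_level b = fun x =>
    (2^-1 + cos (pi * b) / 4) + (- 4^-1) * cos (2 * pi * x + - (pi * b))); last first.
  by apply/funext => x; rewrite /arc_level; field.
apply: trig_add; first exact: trig_cst.
by apply: trig_mul; [exact: trig_cst|exact: trig_cos].
Qed.

Lemma trig_poly_arc_step b m : trig_poly (fun x => (1 - arc_level b x ^+ m) ^+ (2 ^ m)).
Proof.
apply: (@trig_poly_exp (fun x => 1 - arc_level b x ^+ m)).
under eq_fun do rewrite -mulN1r.
apply: trig_add; first exact: trig_cst.
apply: trig_mul; [exact: trig_cst|exact/trig_poly_exp/trig_poly_arc_level].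
Qed.

(** * Functions orthogonal to all trigonometric polynomials *)

Lemma L1_bounded_mulr f g M : L1 f -> measurable_fun I01 g ->
  (forall x, I01 x -> `|g x| <= M) -> L1 (fun x => f x * g x).
Proof.
move=> fi mg gM.
apply: (le_integrable _ _ _ (integrableZl _ M fi)) => //.
  apply/measurable_EFinP; apply: measurable_funM => //.
  by move/measurable_int : fi => /measurable_EFinP.
move=> x xI /=; rewrite lee_fin normrM [X in _ <= X]normrM mulrC ler_wpM2r//.
by rewrite (le_trans (gM x xI))// ler_norm.
Qed.

Lemma trig_poly_measurable f : trig_poly f -> measurable_fun I01 f.
Proof.
move=> /trig_poly_continuous cf.
by apply: measurable_funS (continuous_measurable_fun cf).
Qed.

Lemma L1_mul_trig_poly r f : L1 r -> trig_poly f -> L1 (fun x => r x * f x).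
Proof.
move=> ri tf; have [M fM] := trig_poly_bounded tf.
exact: L1_bounded_mulr ri (trig_poly_measurable tf) (fun x _ => fM x).
Qed.

Lemma ae_neq (a : R) : {ae mu, forall x, x != a}.
Proof.
exists [set a]; split; [exact: measurable_set1|exact: lebesgue_measure_set1|].
by move=> x /= /negP; rewrite negbK => /eqP.
Qed.

(* On [0,1] the level function [arc_level b] is 1/2 exactly at 0, b and 1, so its
   powers converge boundedly to the indicator of [0,b] away from these points. *)
Lemma Rintegral_initial_eq0 (r : R -> R) (b : R) : L1 r -> 0 < b < 1 ->
  (forall f, trig_poly f -> \int[mu]_(x in I01) (r x * f x) = 0) ->
  \int[mu]_(x in `[0, b]) r x = 0.
Proof.
move=> ri /andP[b0 b1] orth.
pose phi m x := (1 - arc_level b x ^+ m) ^+ (2 ^ m).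
have tphi m : trig_poly (phi m) by exact: trig_poly_arc_step.
have phi1 m x : `|phi m x| <= 1.
  have /andP[s0 s1] := arc_level_itv b x.
  have a1 : arc_level b x ^+ m <= 1 by rewrite exprn_ile1.
  have a0 : 0 <= arc_level b x ^+ m by rewrite exprn_ge0.
  by rewrite ger0_norm ?exprn_ge0 ?exprn_ile1//; lra.
have mr : measurable_fun I01 r by move/measurable_int : ri => /measurable_EFinP.
have bI : `[0, b] `<=` I01 by apply: subset_itvl; rewrite bnd_simp ltW.
have [] := @dominated_convergence _ _ _ mu I01 (measurable_itv _)
  (fun m x => (r x * phi m x)%:E) (fun x => ((r \_ `[0, b]) x)%:E) (fun x => `|r x|%:E).
- move=> m; apply/measurable_EFinP; apply: measurable_funM => //.
  exact: trig_poly_measurable.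
- apply/measurable_EFinP/measurable_restrict => //.
  by apply: measurable_funS mr => //; exact: subIsetr.
- apply: (@filterS3 _ _ (ae_filter_ringOfSetsType mu) _ _ _ _ _ (ae_neq 0) (ae_neq b) (ae_neq 1)).
  move=> x /= x0 xb x1; rewrite in_itv/= => /andP[x0' x1'].
  have {x0 x0'} x0 : 0 < x by rewrite lt_neqAle eq_sym x0.
  have {x1 x1'} x1 : x < 1 by rewrite lt_neqAle x1.
  apply: cvg_EFin; first exact: nearW.
  rewrite patchE mem_setE in_itv/= (ltW x0)/=.
  have /andP[s0 s1] := arc_level_itv b x.
  have [xb'|xb'] := leP x b.
    rewrite -[X in _ --> X]mulr1; apply: cvgM; first exact: cvg_cst.
    apply: power_step_cvg1; rewrite s0/= arc_level_lt// x0/=.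
    by rewrite lt_neqAle xb.
  rewrite -[X in _ --> X](mulr0 (r x)); apply: cvgM; first exact: cvg_cst.
  by apply: power_step_cvg0; rewrite s1 andbT arc_level_gt// xb'.
- exact: integrable_norm.
- apply: aeW => x m _ /=; rewrite lee_fin normrM ler_piMr//.
(* Orthogonality makes every integral in the sequence zero, so its limit, the integral of r over
   [0, b], is zero. *)
move=> _ _; rewrite [X in X @ _ --> _](_ : _ = cst 0%E); last first.
  apply/funext => m /=.
  have := congr1 EFin (orth _ (tphi m)).
  by rewrite fineK//; apply: integrable_fin_num => //; exact: L1_mul_trig_poly.
move=> /(cvg_unique _ (cvg_cst 0%E)) => /(_ (@ereal_hausdorff _)) h.
rewrite -(setIidr bI) Rintegral_mkcondr /Rintegral; by rewrite -h.
Qed.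

(** The primitive of r vanishes on ]0, 1[, and almost everywhere its derivative is r. *)
Lemma trig_poly_total (r : R -> R) : L1 r ->
  (forall f, trig_poly f -> \int[mu]_(x in I01) (r x * f x) = 0) ->
  {ae mu, forall x, I01 x -> r x = 0}.
Proof.
move=> ri orth; pose r' := r \_ I01.
have r'T : mu.-integrable setT (EFin \o r').
  by rewrite -restrict_EFin; apply/(integrable_mkcond _ _).1.
(* The differentiation theorem is applied with integrability on [0, y] for every y, also beyond 1;
   hence the extension by zero. *)
have r'i y : mu.-integrable [set` Interval (BLeft 0) (BRight y)] (EFin \o r').
  exact: integrableS r'T.
have := FTC1 r'i (integrable_locally (measurable_itv _) ri).
move=> ftc.
apply: (@filterS3 _ _ (ae_filter_ringOfSetsType mu) _ _ _ _ _ (ae_neq 0) (ae_neq 1) ftc).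
move=> x /= x0 x1 Fx; rewrite in_itv/= => /andP[x0' x1'].
have {x0 x0'} x0 : 0 < x by rewrite lt_neqAle eq_sym x0.
have {x1 x1'} x1 : x < 1 by rewrite lt_neqAle x1.
have [] := Fx; first by rewrite lte_fin.
move=> _; rewrite derive1E.
rewrite (@near_eq_derive _ _ _ _ (cst 0)); last first.
  near=> y.
  have y0 : 0 < y by near: y; exact: lt_nbhsr.
  have y1 : y < 1 by near: y; exact: lt_nbhsl.
  rewrite /=.
  transitivity (\int[mu]_(t in `[0, y]) r t); last first.
    by rewrite (@Rintegral_initial_eq0 r y)// ?y0.
  apply: eq_Rintegral => z; rewrite mem_setE in_itv/= => /andP[z0 zy].
  by rewrite /r' patchE mem_setE in_itv/= z0 (le_trans zy (ltW y1)).
rewrite derive_cst /r' patchE mem_setE in_itv/= (ltW x0) (ltW x1)/= => <- //.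
Unshelve. all: by end_near. Qed.

(** * Complex-valued integrals *)

(** Writing the weight (1 - x)^(k+1) as an integral over [x, 1] allows Fubini on the triangle to
    lower the order of a moment. *)
Lemma Rintegral_onemX k x : x \in I01 ->
  \int[mu]_(y in `[x, 1]) (k.+1%:R * (1 - y) ^+ k) = (1 - x) ^+ k.+1.
Proof.
rewrite mem_setE in_itv/= => /andP[_]; rewrite le_eqVlt => /predU1P[->|x1].
  (* At x = 1 the interval is a point, and the right side is 0 because the exponent is positive. *)
  by rewrite set_itv1 Rintegral_set1 subrr expr0n.
have cX m : continuous (fun y : R => (1 - y) ^+ m).
  by move=> y; exact: continuous_onemXn.
have cM : continuous (fun y : R => k.+1%:R * (1 - y) ^+ k).
  by move=> y; apply: cvgM; [exact: cvg_cst|exact: cX].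
have dX (y : R) : is_derive y 1 (fun y : R => - (1 - y) ^+ k.+1) (k.+1%:R * (1 - y) ^+ k).
  rewrite -[X in is_derive _ _ _ X]opprK -mulNr; apply: is_deriveN.
  have d : derivable (fun y : R => (1 - y) ^+ k.+1) y 1 by exact: onemXn_derivable.
  by split=> //; rewrite -derive1E; exact: derive_onemXn.
rewrite /Rintegral (@continuous_FTC2 _ _ (fun y => - (1 - y) ^+ k.+1))//.
- by rewrite subrr expr0n/= oppr0 sub0r opprK.
- exact: (continuous_subspaceT cM).
- split.
  + by move=> y _; have [] := dX y.
  + by apply: cvgN; apply: cvg_at_right_filter; exact: cX.
  + by apply: cvgN; apply: cvg_at_left_filter; exact: cX.
- by move=> y _; rewrite derive1E; have [_ ->] := dX y.
Qed.

Lemma continuous_L1 f : continuous f -> L1 f.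
Proof.
move=> cf; apply: continuous_compact_integrable; first exact: segment_compact.
exact: continuous_subspaceT.
Qed.

Local Notation C := R[i].
Implicit Types (a b : R -> C) (z : C).

Lemma reCD z1 z2 : reC (z1 + z2) = reC z1 + reC z2. Proof. by case: z1 z2 => ? ? []. Qed.
Lemma imCD z1 z2 : imC (z1 + z2) = imC z1 + imC z2. Proof. by case: z1 z2 => ? ? []. Qed.
Lemma reCN z : reC (- z) = - reC z. Proof. by case: z. Qed.
Lemma imCN z : imC (- z) = - imC z. Proof. by case: z. Qed.
Lemma reCM z1 z2 : reC (z1 * z2) = reC z1 * reC z2 - imC z1 * imC z2.
Proof. by case: z1 z2 => ? ? []. Qed.
Lemma imCM z1 z2 : imC (z1 * z2) = reC z1 * imC z2 + imC z1 * reC z2.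
Proof. by case: z1 z2 => ? ? []. Qed.
Lemma reC_conj z : reC z^* = reC z. Proof. by case: z. Qed.
Lemma imC_conj z : imC z^* = - imC z. Proof. by case: z. Qed.
Lemma reC_real (x : R) : reC x%:C%C = x. Proof. by []. Qed.
Lemma imC_real (x : R) : imC x%:C%C = 0. Proof. by []. Qed.
Definition reimE := (reCD, imCD, reCN, imCN, reCM, imCM, reC_conj, imC_conj, reC_real, imC_real).

Lemma eqC z1 z2 : reC z1 = reC z2 -> imC z1 = imC z2 -> z1 = z2.
Proof. by case: z1 z2 => ? ? [? ?] /= -> ->. Qed.

Definition cintegrable (A : set R) a :=
  mu.-integrable A (EFin \o (fun x => reC (a x))) /\
  mu.-integrable A (EFin \o (fun x => imC (a x))).

Section cint_linear.
Variables (A : set R) (mA : measurable (A : set (measurableTypeR R))).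

Lemma integrableDR (f g : R -> R) : mu.-integrable A (EFin \o f) ->
  mu.-integrable A (EFin \o g) -> mu.-integrable A (EFin \o (fun x => f x + g x)).
Proof. by move=> fi gi; have := integrableD mA fi gi; apply: eq_integrable. Qed.

Lemma integrableBR (f g : R -> R) : mu.-integrable A (EFin \o f) ->
  mu.-integrable A (EFin \o g) -> mu.-integrable A (EFin \o (fun x => f x - g x)).
Proof. by move=> fi gi; have := integrableB mA fi gi; apply: eq_integrable. Qed.

Lemma integrableZR k (f : R -> R) : mu.-integrable A (EFin \o f) ->
  mu.-integrable A (EFin \o (fun x => k * f x)).
Proof. by move=> fi; have := integrableZl mA k fi; apply: eq_integrable. Qed.

Lemma integrableNR (f : R -> R) : mu.-integrable A (EFin \o f) ->
  mu.-integrable A (EFin \o (fun x => - f x)).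
Proof. by move=> fi; have := integrableN fi; apply: eq_integrable. Qed.

Lemma eq_cintegrable a b : {in A, a =1 b} -> cintegrable A a -> cintegrable A b.
Proof.
by move=> ab [ra ia]; split; [move: ra|move: ia];
  apply: eq_integrable => // x xA /=; rewrite ab.
Qed.

Lemma eq_cint a b : {in A, a =1 b} -> cint A a = cint A b.
Proof. by move=> ab; congr Complex; apply: eq_Rintegral => x xA; rewrite ab. Qed.

Lemma cintegrableD a b : cintegrable A a -> cintegrable A b ->
  cintegrable A (fun x => a x + b x).
Proof.
move=> [ra ia] [rb ib]; split.
  by under eq_fun do rewrite reimE; exact: integrableDR.
by under eq_fun do rewrite reimE; exact: integrableDR.
Qed.

Lemma cintD a b : cintegrable A a -> cintegrable A b ->
  cint A (fun x => a x + b x) = cint A a + cint A b.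
Proof.
move=> [ra ia] [rb ib]; apply: eqC; rewrite reimE/=;
  by under eq_fun do rewrite reimE; rewrite RintegralD.
Qed.

Lemma cintegrableZ z a : cintegrable A a -> cintegrable A (fun x => z * a x).
Proof.
move=> [ra ia]; split.
  by under eq_fun do rewrite reimE; apply: integrableBR; exact: integrableZR.
by under eq_fun do rewrite reimE; apply: integrableDR; exact: integrableZR.
Qed.

Lemma cintZ z a : cintegrable A a -> cint A (fun x => z * a x) = z * cint A a.
Proof.
move=> [ra ia]; apply: eqC; rewrite reimE/=.
  under eq_fun do rewrite reimE.
  by rewrite RintegralB// ?RintegralZl//; exact: integrableZR.
under eq_fun do rewrite reimE.
by rewrite RintegralD// ?RintegralZl//; exact: integrableZR.
Qed.

Lemma cintegrableN a : cintegrable A a -> cintegrable A (fun x => - a x).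
Proof.
by move=> /(cintegrableZ (-1)); under eq_fun do rewrite mulN1r.
Qed.

Lemma cintN a : cintegrable A a -> cint A (fun x => - a x) = - cint A a.
Proof.
by move=> /(cintZ (-1)); rewrite mulN1r; under eq_fun do rewrite mulN1r.
Qed.

Lemma cintegrableB a b : cintegrable A a -> cintegrable A b ->
  cintegrable A (fun x => a x - b x).
Proof. by move=> ai /cintegrableN bi; exact: cintegrableD. Qed.

Lemma cintB a b : cintegrable A a -> cintegrable A b ->
  cint A (fun x => a x - b x) = cint A a - cint A b.
Proof. by move=> ai bi; rewrite cintD ?cintN//; exact: cintegrableN. Qed.

Lemma cintegrable_conj a : cintegrable A a -> cintegrable A (fun x => (a x)^*).
Proof.
move=> [ra ia]; split; first by under eq_fun do rewrite reimE.
by under eq_fun do rewrite reimE; exact: integrableNR.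
Qed.

Lemma cint_conj a : cintegrable A a -> cint A (fun x => (a x)^*) = (cint A a)^*.
Proof.
move=> [ra ia]; apply: eqC; rewrite reimE/=; first by under eq_fun do rewrite reimE.
under eq_fun do rewrite reimE; under eq_Rintegral do rewrite -mulN1r.
by rewrite RintegralZl// mulN1r.
Qed.

End cint_linear.

Lemma L1_cst (k : R) : L1 (fun=> k).
Proof. by apply: continuous_L1 => x; exact: cst_continuous. Qed.

Lemma L2_cintegrable a : L2 a -> cintegrable I01 a.
Proof.
move=> [mr mi fin].
(* On an interval of finite length, |t| <= 1 + t^2 gives the inclusion of L^2 in L^1. *)
have dom : L1 (fun x => 1 + (reC (a x) ^+ 2 + imC (a x) ^+ 2)).
  apply: integrableDR => //; first exact: L1_cst.
  apply/integrableP; split.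
    by apply/measurable_EFinP/measurable_funD; exact: measurable_funX.
  under eq_integral do rewrite /= ger0_norm ?addr_ge0 ?sqr_ge0//.
  exact: fin.
split; apply: (le_integrable _ _ _ dom) => //; try exact/measurable_EFinP.
- move=> x _ /=; rewrite lee_fin ler_norml ger0_norm; last by rewrite !addr_ge0 ?sqr_ge0.
  by apply/andP; split; nra.
- move=> x _ /=; rewrite lee_fin ler_norml ger0_norm; last by rewrite !addr_ge0 ?sqr_ge0.
  by apply/andP; split; nra.
Qed.

Lemma cintegrable_real (f : R -> R) : L1 f -> cintegrable I01 (fun x => (f x)%:C%C).
Proof.
by move=> fi; split=> //; exact: L1_cst.
Qed.

Lemma cint_real A (f : R -> R) : cint A (fun x => (f x)%:C%C) = (Rintegral mu A f)%:C%C.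
Proof. by apply: eqC => //=; rewrite /Rintegral integral0. Qed.

Lemma subset_0x_I01 x : x \in I01 -> `[0, x] `<=` I01.
Proof.
by rewrite mem_setE in_itv/= => /andP[x0 x1]; apply: subset_itvl; rewrite bnd_simp.
Qed.

Lemma cintegrable_0x a x : cintegrable I01 a -> x \in I01 -> cintegrable `[0, x] a.
Proof.
move=> [ra ia] xI; split; [apply: integrableS ra => //|apply: integrableS ia => //];
  exact: subset_0x_I01.
Qed.

Lemma cintegrable_primitiveM a b : cintegrable I01 a -> cintegrable I01 b ->
  cintegrable I01 (fun x => cint `[0, x] a * b x).
Proof.
move=> [ra ia] [rb ib]; split.
  have := integrableBR _ (integrable_primitiveM ra rb) (integrable_primitiveM ia ib).
  by move=> /(_ (measurable_itv _)); apply: eq_integrable => // x _ /=; rewrite reimE.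
have := integrableDR _ (integrable_primitiveM ra ib) (integrable_primitiveM ia rb).
by move=> /(_ (measurable_itv _)); apply: eq_integrable => // x _ /=; rewrite reimE.
Qed.

Lemma cint_primitiveM a b : cintegrable I01 a -> cintegrable I01 b ->
  cint I01 (fun x => cint `[0, x] a * b x) = cint I01 (fun x => a x * cint `[x, 1] b).
Proof.
move=> [ra ia] [rb ib]; apply: eqC => /=.
  under eq_Rintegral do rewrite reCM/=.
  under [in RHS]eq_Rintegral do rewrite reCM/=.
  rewrite RintegralB//; try exact: integrable_primitiveM.
  rewrite RintegralB//; try exact: integrable_coprimitiveM.
  by rewrite !Rintegral_primitiveM.
under eq_Rintegral do rewrite imCM/=.
under [in RHS]eq_Rintegral do rewrite imCM/=.
rewrite RintegralD//; try exact: integrable_primitiveM.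
rewrite RintegralD//; try exact: integrable_coprimitiveM.
by rewrite !Rintegral_primitiveM.
Qed.

Lemma cint_coprimitive a x : cintegrable I01 a -> x \in I01 ->
  cint `[x, 1] a = cint I01 a - cint `[0, x] a.
Proof. by move=> [ra ia] xI; apply: eqC; rewrite reimE/= (@Rintegral_coprimitive _ x). Qed.

Lemma ae_eq_cint a b : 
  measurable_fun I01 (fun x => reC (a x)) -> measurable_fun I01 (fun x => imC (a x)) ->
  measurable_fun I01 (fun x => reC (b x)) -> measurable_fun I01 (fun x => imC (b x)) ->
  {ae mu, forall x, I01 x -> a x = b x} -> cint I01 a = cint I01 b.
Proof.
move=> mra mia mrb mib ab; congr Complex; congr fine.
all: apply: ae_eq_integral => //; try exact/measurable_EFinP.
all: apply: (@filterS _ _ (ae_filter_ringOfSetsType mu) _ _ _ ab) => x /= h xI.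
all: by rewrite (h xI).
Qed.

Lemma DT_trig_poly f : trig_poly f -> DT (fun x => (f x)%:C%C).
Proof.
by move=> tf; split; [exact: trig_poly_smoothT|exact: trig_poly_smoothT (trig_cst 0)].
Qed.

Lemma cintMr A a (f : R -> R) : cint A (fun x => a x * (f x)%:C%C) =
  Complex (\int[mu]_(x in A) (reC (a x) * f x)) (\int[mu]_(x in A) (imC (a x) * f x)).
Proof.
apply: eqC => /=; apply: eq_Rintegral => x _.
  by rewrite reCM/= mulr0 subr0.
by rewrite imCM/= mulr0 add0r.
Qed.

(** Pairing with a real f acts on real and imaginary parts separately, so the real totality result
    applies to each difference. *)
Lemma trig_poly_ctotal a b : cintegrable I01 a -> cintegrable I01 b ->
  (forall f, trig_poly f -> cint I01 (fun x => a x * (f x)%:C%C) =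
                            cint I01 (fun x => b x * (f x)%:C%C)) ->
  {ae mu, forall x, I01 x -> a x = b x}.
Proof.
move=> [ra ia] [rb ib] ab.
have re0 : {ae mu, forall x, I01 x -> reC (a x) - reC (b x) = 0}.
  apply: trig_poly_total; first exact: integrableBR.
  move=> f tf; under eq_Rintegral do rewrite mulrBl.
  rewrite RintegralB//; try exact: L1_mul_trig_poly.
  by have := ab _ tf; rewrite !cintMr => -[-> _]; rewrite subrr.
have im0 : {ae mu, forall x, I01 x -> imC (a x) - imC (b x) = 0}.
  apply: trig_poly_total; first exact: integrableBR.
  move=> f tf; under eq_Rintegral do rewrite mulrBl.
  rewrite RintegralB//; try exact: L1_mul_trig_poly.
  by have := ab _ tf; rewrite !cintMr => -[_ ->]; rewrite subrr.
apply: (@filterS2 _ _ (ae_filter_ringOfSetsType mu) _ _ _ _ re0 im0).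
move=> x /= r0 i0 xI; apply: eqC; apply/eqP; rewrite -subr_eq0; apply/eqP.
  exact: r0.
exact: i0.
Qed.

(** * The functionals on test functions *)

Lemma mu_k_real k (f : R -> R) :
  mu_k k (fun x => (f x)%:C%C) = (\int[mu]_(x in I01) ((1 - x) ^+ k * f x))%:C%C.
Proof.
rewrite /mu_k -cint_real; apply: eq_cint => x _.
by rewrite -rmorphM.
Qed.

Lemma conjC_real (x : R) : (x%:C)%C^* = x%:C%C :> C.
Proof. by apply: eqC; rewrite !reimE// oppr0. Qed.

Definition Jn_realfun n (f : R -> R) x :=
  \int[mu]_(y in `[x, 1]) f y - \int[mu]_(y in I01) f y * (1 - x) ^+ n.

Lemma Jn_realE n (f : R -> R) :
  Jn n (fun x => (f x)%:C%C) = (fun x => (Jn_realfun n f x)%:C%C).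
Proof.
apply/funext => x; rewrite /Jn cint_real mu_k_real -rmorphM -rmorphB.
by under [X in _ - X * _]eq_Rintegral do rewrite expr0 mul1r.
Qed.

Lemma Rintegral_onemX_0x k x : x \in I01 ->
  \int[mu]_(y in `[0, x]) (k.+1%:R * (1 - y) ^+ k) = 1 - (1 - x) ^+ k.+1.
Proof.
move=> xI; have cI : L1 (fun y => k.+1%:R * (1 - y) ^+ k).
  apply: continuous_L1 => y; apply: cvgM; first exact: cvg_cst.
  exact: continuous_onemXn.
have := Rintegral_coprimitive cI xI; rewrite !Rintegral_onemX//; last first.
  by rewrite mem_setE in_itv/= lexx ler01.
by rewrite subr0 expr1n => ->; rewrite opprB addrC subrK.
Qed.

Lemma continuous_L2 (g : R -> R) : continuous g -> L2 (fun x => (g x)%:C%C).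
Proof.
move=> cg; split=> /=.
- by apply: measurable_funS (continuous_measurable_fun cg).
- exact: measurable_cst.
- have /integrableP[_ gg] : L1 (fun x => g x * g x).
    by apply: continuous_L1 => x; apply: cvgM; exact: cg.
  under eq_integral do rewrite expr0n/= addr0.
  under eq_integral => x _ do rewrite -[g x ^+ 2]ger0_norm ?sqr_ge0// expr2.
  exact: gg.
Qed.

Lemma wderiv_Jn n (f : R -> R) : continuous f ->
  wderiv (Jn n.+1 (fun x => (f x)%:C%C))
    (fun x => (- f x + \int[mu]_(y in I01) f y * (n.+1%:R * (1 - x) ^+ n))%:C%C).
Proof.
move=> cf; have cX : continuous (fun x : R => n.+1%:R * (1 - x) ^+ n).
  by move=> y; apply: cvgM; [exact: cvg_cst|exact: continuous_onemXn].
split.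
  apply: continuous_L2 => x; apply: cvgD; first by apply: cvgN; exact: cf.
  by apply: cvgM; [exact: cvg_cst|exact: cX].
move=> x xI; rewrite Jn_realE cint_real -rmorphD; congr (_%:C)%C.
have [fx _] : cintegrable `[0, x] (fun x => (f x)%:C%C).
  by apply: cintegrable_0x; [exact/cintegrable_real/continuous_L1|by []].
have [Xx _] : cintegrable `[0, x] (fun x => (n.+1%:R * (1 - x) ^+ n)%:C%C).
  by apply: cintegrable_0x; [exact/cintegrable_real/continuous_L1|by []].
rewrite RintegralD//; [|exact: integrableNR|exact: integrableZR].
rewrite RintegralZl// Rintegral_onemX_0x//.
under [X in _ + (X + _)]eq_Rintegral do rewrite -mulN1r.
rewrite RintegralZl// /Jn_realfun subr0 expr1n mulr1 subrr.
rewrite (@Rintegral_coprimitive _ x)//; last exact: continuous_L1.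
by ring.
Qed.

(** The subtracted multiple of (1 - x)^(n+1) cancels the integral of f at 0 and vanishes at 1. Thus
    the identity of [is_IdmInv_u2] on H^1_0 can be tested on [Jn]. *)
Lemma H10_Jn n (f : R -> R) : continuous f -> H10 (Jn n.+1 (fun x => (f x)%:C%C)).
Proof.
move=> cf; split; first by eexists; exact: wderiv_Jn.
rewrite Jn_realE /Jn_realfun; split.
  by rewrite subr0 expr1n mulr1 subrr.
by rewrite set_itv1 Rintegral_set1 subrr expr0n/= mulr0 subrr.
Qed.

Lemma cintegrable_cst z : cintegrable I01 (fun=> z).
Proof. by split; exact: L1_cst. Qed.

Lemma cint_cst z : cint I01 (fun=> z) = z.
Proof.
by apply: eqC; rewrite /cint/= Rintegral_cst//= lebesgue_measure_itv/= lte_fin ltr01 oppr0 adde0 mulr1.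
Qed.

Lemma cintegrable_onemX_mul k a : cintegrable I01 a ->
  cintegrable I01 (fun x => ((1 - x) ^+ k)%:C%C * a x).
Proof.
have cX : continuous (fun x : R => (1 - x) ^+ k) by move=> y; exact: continuous_onemXn.
have mX : measurable_fun I01 (fun x : R => (1 - x) ^+ k).
  by apply: measurable_funS (continuous_measurable_fun cX).
have X1 x : I01 x -> `|(1 - x) ^+ k| <= 1.
  rewrite /= in_itv/= => /andP[x0 x1].
  by rewrite ger0_norm ?exprn_ge0 ?exprn_ile1//; lra.
move=> [ra ia]; split.
  have := L1_bounded_mulr ra mX X1; apply: eq_integrable => // x _ /=.
  by rewrite reCM/= mul0r subr0 mulrC.
have := L1_bounded_mulr ia mX X1; apply: eq_integrable => // x _ /=.
by rewrite imCM/= mul0r addr0 mulrC.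
Qed.

Lemma cintegrable_mul_trig_poly a f : cintegrable I01 a -> trig_poly f ->
  cintegrable I01 (fun x => a x * (f x)%:C%C).
Proof.
move=> [ra ia] tf; split.
  have := L1_mul_trig_poly ra tf; apply: eq_integrable => // x _ /=.
  by rewrite reCM/= mulr0 subr0.
have := L1_mul_trig_poly ia tf; apply: eq_integrable => // x _ /=.
by rewrite imCM/= mulr0 add0r.
Qed.

Lemma cintegrable_coprimitiveM a b : cintegrable I01 a -> cintegrable I01 b ->
  cintegrable I01 (fun x => a x * cint `[x, 1] b).
Proof.
move=> ai bi.
apply: (@eq_cintegrable _ _ (fun x => cint I01 b * a x - cint `[0, x] b * a x)) => //.
  move=> x xI; rewrite [in RHS]cint_coprimitive//; ring.
by apply: cintegrableB => //; [exact: cintegrableZ|exact: cintegrable_primitiveM].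
Qed.

(** This identifies the pairings of P_(k+1) w with those of u' - (k+1) mu_k(u'), by inserting the
    derivative of [Jn] into the formula for w. *)
Lemma IdmInv_Jn k u' w f : cintegrable I01 u' -> is_IdmInv_u2 u' w -> trig_poly f ->
  w (Jn k.+1 (fun x => (f x)%:C%C)) =
  cint I01 (fun x => (u' x - k.+1%:R * mu_k k u') * (f x)%:C%C).
Proof.
move=> u'i [_ _ wE] tf; have cf := trig_poly_continuous tf.
rewrite (wE _ _ (H10_Jn k cf) (wderiv_Jn k cf)).
set F := Rintegral _ _ _.
have u'f := cintegrable_mul_trig_poly u'i tf.
have u'X := cintegrable_onemX_mul k u'i.
have fi : cintegrable I01 (fun x => (f x)%:C%C).
  exact/cintegrable_real/continuous_L1.
transitivity (- cint I01 (fun x =>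
    F%:C%C * k.+1%:R * (((1 - x) ^+ k)%:C%C * u' x) - u' x * (f x)%:C%C)).
  congr (- _); apply: eq_cint => x _.
  rewrite conjC_real rmorphD rmorphN !rmorphM rmorph_nat; ring.
rewrite cintB//; last exact: cintegrableZ.
rewrite cintZ// -/(mu_k k u').
(* Since F is the integral of f, the moment term becomes the pairing of a constant with f. *)
transitivity (cint I01 (fun x => u' x * (f x)%:C%C - k.+1%:R * mu_k k u' * (f x)%:C%C)).
  rewrite cintB//; last exact: cintegrableZ.
  rewrite cintZ// cint_real -/F; ring.
by apply: eq_cint => x _; rewrite mulrBl.
Qed.

(** Fubini on the triangle moves the integration from f to h, and the subtracted term of [Jn] yields
    the constant mu_k(h). *)
Lemma embL2_Jn k h f : cintegrable I01 h -> trig_poly f ->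
  embL2 h (Jn k (fun x => (f x)%:C%C)) =
  cint I01 (fun x => (cint `[0, x] h - mu_k k h) * (f x)%:C%C).
Proof.
move=> hi tf; have cf := trig_poly_continuous tf.
have fi : cintegrable I01 (fun x => (f x)%:C%C).
  exact/cintegrable_real/continuous_L1.
have hX := cintegrable_onemX_mul k hi.
set F := Rintegral mu I01 f.
transitivity (cint I01 (fun x => h x * cint `[x, 1] (fun x => (f x)%:C%C)
   - F%:C%C * (((1 - x) ^+ k)%:C%C * h x))).
  apply: eq_cint => x _; rewrite Jn_realE conjC_real /Jn_realfun cint_real.
  rewrite rmorphB rmorphM; ring.
rewrite cintB//; [|exact: cintegrable_coprimitiveM|exact: cintegrableZ].
rewrite cintZ// -/(mu_k k h) -cint_primitiveM//.
transitivity (cint I01 (fun x => cint `[0, x] h * (f x)%:C%C - mu_k k h * (f x)%:C%C)).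
  rewrite cintB//; [|exact: cintegrable_primitiveM|exact: cintegrableZ].
  rewrite cintZ// cint_real -/F; ring.
by apply: eq_cint => x _; rewrite mulrBl.
Qed.

(** * Integration by parts with a weak derivative *)

Lemma wderiv_primitive u u' x : wderiv u u' -> x \in I01 -> cint `[0, x] u' = u x - u 0.
Proof. by move=> [_ uE] xI; rewrite (uE _ xI) addrC addKr. Qed.

Lemma mem01 : ((0 : R) \in I01) * ((1 : R) \in I01).
Proof. by rewrite !mem_setE !in_itv/= !lexx ler01. Qed.

Lemma cintegrable_wderivM u u' b : wderiv u u' -> cintegrable I01 b ->
  cintegrable I01 (fun x => u x * b x).
Proof.
move=> uu' bi; have u'i := L2_cintegrable uu'.1.
apply: (@eq_cintegrable _ _ (fun x => cint `[0, x] u' * b x + u 0 * b x)) => //.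
  move=> x xI; rewrite (wderiv_primitive uu' xI); ring.
by apply: cintegrableD => //; [exact: cintegrable_primitiveM|exact: cintegrableZ].
Qed.

(** With the weight written as the integral of g over [x, 1], exchanging the order integrates (u -
    u(0)) g, and g has total integral 1. *)
Lemma mu_k_wderiv k (u u' : R -> C) : wderiv u u' ->
  mu_k k.+1 u' = k.+1%:R * mu_k k u - u 0.
Proof.
move=> uu'; have u'i := L2_cintegrable uu'.1.
have ui : cintegrable I01 u.
  have := cintegrable_wderivM uu' (cintegrable_cst 1).
  by apply: eq_cintegrable => // x _; rewrite mulr1.
pose g (y : R) := k.+1%:R * (1 - y) ^+ k.
have gi : cintegrable I01 (fun x => (g x)%:C%C).
  apply/cintegrable_real/continuous_L1 => y; apply: cvgM; first exact: cvg_cst.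
  exact: continuous_onemXn.
transitivity (cint I01 (fun x => u' x * cint `[x, 1] (fun x => (g x)%:C%C))).
  by apply: eq_cint => x xI; rewrite cint_real Rintegral_onemX// mulrC.
rewrite -cint_primitiveM//.
transitivity (cint I01 (fun x =>
    k.+1%:R * (((1 - x) ^+ k)%:C%C * u x) - u 0 * (g x)%:C%C)).
  apply: eq_cint => x xI; rewrite (wderiv_primitive uu' xI) /g rmorphM rmorph_nat; ring.
have uX := cintegrable_onemX_mul k ui.
rewrite cintB//; [|exact: cintegrableZ|exact: cintegrableZ].
rewrite !cintZ// cint_real Rintegral_onemX ?mem01// subr0 expr1n.
by rewrite rmorph1 mulr1.
Qed.

Lemma cint_primitive_conj (h : R -> C) : cintegrable I01 h ->
  cint I01 (fun x => (cint `[0, x] h)^*) = (mu_k 1 h)^*.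
Proof.
move=> hi; have c1 := cintegrable_cst 1.
have Hi : cintegrable I01 (fun x => cint `[0, x] h * 1) by exact: cintegrable_primitiveM.
rewrite cint_conj//; last first.
  by move: Hi; apply: eq_cintegrable => // x _; rewrite mulr1.
congr (_^*); transitivity (cint I01 (fun x => cint `[0, x] h * 1)).
  by apply: eq_cint => x _; rewrite mulr1.
rewrite cint_primitiveM//; apply: eq_cint => x xI.
rewrite mulrC expr1; congr (_ * _).
(* The integral of 1 over [x, 1] is the weight 1 - x of [mu_k 1]. *)
have := Rintegral_onemX 0 xI; rewrite expr1 => <-.
by rewrite -cint_real; apply: eq_cint => y _; rewrite expr0 mulr1.
Qed.

Lemma cint_wderiv_primitive_conj (u u' h : R -> C) : wderiv u u' -> cintegrable I01 h ->
  cint I01 (fun x => u' x * (cint `[0, x] h)^*) =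
  u 1 * (mu_k 0 h)^* - cint I01 (fun x => u x * (h x)^*).
Proof.
move=> uu' hi; have u'i := L2_cintegrable uu'.1.
have hci : cintegrable I01 (fun x => (h x)^*) by exact: cintegrable_conj.
transitivity (cint I01 (fun x => cint `[0, x] (fun y => (h y)^*) * u' x)).
  by apply: eq_cint => x xI; rewrite mulrC cint_conj//; exact: cintegrable_0x.
rewrite cint_primitiveM//.
transitivity (cint I01 (fun x => u 1 * (h x)^* - u x * (h x)^*)).
  apply: eq_cint => x xI; rewrite cint_coprimitive// !(wderiv_primitive uu')// ?mem01//; ring.
rewrite cintB//; [|exact: cintegrableZ|exact: cintegrable_wderivM uu' hci].
rewrite cintZ// cint_conj//; congr (_ * _^* - _).
by apply: eq_cint => x _; rewrite expr0 mul1r.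
Qed.

(** * The inner product *)

Lemma cintegrable_measurable a : cintegrable I01 a ->
  measurable_fun I01 (fun x => reC (a x)) /\ measurable_fun I01 (fun x => imC (a x)).
Proof.
by move=> [ra ia]; split; [move/measurable_int : ra|move/measurable_int : ia]
  => /measurable_EFinP.
Qed.

(** Allows L^2 representatives to be exchanged in the inner product; the auxiliary [mM] supplies the
    measurability of the products. *)
Lemma ae_eq_cint_mul_conj a a' b b' :
  cintegrable I01 a -> cintegrable I01 a' -> cintegrable I01 b -> cintegrable I01 b' ->
  {ae mu, forall x, I01 x -> a x = a' x} -> {ae mu, forall x, I01 x -> b x = b' x} ->
  cint I01 (fun x => a x * (b x)^*) = cint I01 (fun x => a' x * (b' x)^*).
Proof.
have mM (f g : R -> C) : cintegrable I01 f -> cintegrable I01 g ->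
    measurable_fun I01 (fun x => reC (f x * (g x)^*)) /\
    measurable_fun I01 (fun x => imC (f x * (g x)^*)).
  move=> /cintegrable_measurable[rf jf] /cintegrable_measurable[rg jg]; split.
    apply: (eq_measurable_fun (fun x => reC (f x) * reC (g x) + imC (f x) * imC (g x))).
      by move=> x _; rewrite !reimE mulrN opprK.
    by apply: measurable_funD; exact: measurable_funM.
  apply: (eq_measurable_fun (fun x => imC (f x) * reC (g x) - reC (f x) * imC (g x))).
    by move=> x _; rewrite !reimE mulrN addrC.
  by apply: measurable_funB; exact: measurable_funM.
move=> ai a'i bi b'i aa' bb'.
have [mr mi] := mM _ _ ai bi; have [mr' mi'] := mM _ _ a'i b'i.
apply: ae_eq_cint => //.
apply: (@filterS2 _ _ (ae_filter_ringOfSetsType mu) _ _ _ _ aa' bb').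
by move=> x /= ax bx xI; rewrite (ax xI) (bx xI).
Qed.

Lemma Hm1T_inner_IdmInv k (u u' h p q : R -> C) w :
  wderiv u u' -> L2 h -> is_IdmInv_u2 u' w -> is_Pn k.+2 w p -> is_Pn k.+2 (embL2 h) q ->
  Hm1T_inner w (embL2 h) p q =
    - cint I01 (fun x => u x * (h x)^*) + u 1 * (mu_k 0 h)^*
    + (k.+2%:R * u 0 - (k.+2 * k.+1)%:R * mu_k k u) * (mu_k 1 h)^*
    + ((1 - k.+2%:R) * u 0 - u 1 + (k.+2 * k.+1)%:R * mu_k k u) * (mu_k k.+2 h)^*.
Proof.
move=> uu' h2 wu [p2 wp] [q2 hq].
have u'i := L2_cintegrable uu'.1; have hi := L2_cintegrable h2.
have pi := L2_cintegrable p2; have qi := L2_cintegrable q2.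
pose c : C := k.+2%:R * mu_k k.+1 u'; pose m := mu_k k.+2 h.
pose H x := cint `[0, x] h.
have Hi : cintegrable I01 H.
  have := cintegrable_primitiveM hi (cintegrable_cst 1).
  by apply: eq_cintegrable => // x _; rewrite mulr1.
have ci z : cintegrable I01 (fun=> z) by exact: cintegrable_cst.
have p0i : cintegrable I01 (fun x => u' x - c) by exact: cintegrableB.
have q0i : cintegrable I01 (fun x => H x - m) by exact: cintegrableB.
(* [is_Pn] pairs with the conjugate of the test function, which for real test functions is the
   function itself. *)
have conjf (g : R -> C) (f : R -> R) :
    cint I01 (fun x => g x * ((f x)%:C%C)^*) = cint I01 (fun x => g x * (f x)%:C%C).
  by apply: eq_cint => x _; rewrite conjC_real.
have pE : {ae mu, forall x, I01 x -> p x = u' x - c}.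
  apply: trig_poly_ctotal => // f tf.
  by rewrite -conjf -(wp _ (DT_trig_poly tf)) (IdmInv_Jn _ u'i wu tf).
have qE : {ae mu, forall x, I01 x -> q x = H x - m}.
  apply: trig_poly_ctotal => // f tf.
  by rewrite -conjf -(hq _ (DT_trig_poly tf)) (embL2_Jn _ hi tf).
have [_ mw0 _] := wu.
rewrite /Hm1T_inner mw0 mul0r addr0 (ae_eq_cint_mul_conj pi p0i qi q0i pE qE).
have Hci := cintegrable_conj (measurable_itv _) Hi.
have u'Hci : cintegrable I01 (fun x => u' x * (H x)^*).
  have := cintegrable_primitiveM (cintegrable_conj (measurable_itv _) hi) u'i.
  apply: eq_cintegrable => // x xI.
  by rewrite mulrC cint_conj /H; [|by []|exact: cintegrable_0x].
(* The product (u' - c)(H - m)^* is expanded: the first term is integrated by parts, the integral of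
   u' is u(1) - u(0), that of H^* is the conjugate of mu_1(h), and c is rewritten through mu_k(u)
   and u(0). *)
transitivity (cint I01 (fun x =>
    (u' x * (H x)^* - m^* * u' x) - (c * (H x)^* - c * m^*))).
  by apply: eq_cint => x _; rewrite rmorphB; ring.
rewrite cintB//; [|by apply: cintegrableB => //; exact: cintegrableZ..].
rewrite cintB//; last exact: cintegrableZ.
rewrite cintB//; last exact: cintegrableZ.
rewrite !cintZ// cint_cst (cint_wderiv_primitive_conj uu' hi) cint_primitive_conj//.
rewrite (wderiv_primitive uu') ?mem01// /c (mu_k_wderiv _ uu') -/m natrM; ring.
Qed.

End NegativeSobolevTorus.

Local Open Scope complex_scope.

(* u ∈ H^1(0,1) with weak derivative u', h ∈ L^2(0,1);
   w = Id_m^{-1}(u''); p, q ∈ L^2 represent P_n w and P_n h. *)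
Theorem mainTheorem3 (R : realType) (n : nat) (u u' h : R -> R[i])
    (w : (R -> R[i]) -> R[i]) (p q : R -> R[i]) :
  (2 <= n)%N ->
  wderiv u u' ->
  L2 h ->
  is_IdmInv_u2 u' w ->
  is_Pn n w p ->
  is_Pn n (embL2 h) q ->
  Hm1T_inner w (embL2 h) p q =
    - cint (`[0%R, 1%R]%classic : set R) (fun x => u x * (h x)^*)
    + u 1%R * (mu_k 0 h)^*
    + (n%:R * u 0%R - (n * (n - 1))%:R * mu_k (n - 2) u) * (mu_k 1 h)^*
    + ((1 - n%:R) * u 0%R - u 1%R + (n * (n - 1))%:R * mu_k (n - 2) u)
        * (mu_k n h)^*.
Proof.
(* Writing n = k + 2 turns the natural subtractions n - 1 and n - 2 into k + 1 and k. *)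
case: n => [//|[//|k]] _ uu' h2 wu pw qh.
by rewrite (Hm1T_inner_IdmInv uu' h2 wu pw qh) !subSS !subn0.
Qed.
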